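(* Let $l\ge1$, $\vec n=(n_l,\dots,n_0)$ with all $n_i\ge1$, $\gamma>0$, $1\le p<\infty$, $0<q\le\infty$, and let $\mathcal C^{l,\vec n}_{\gamma_{p,q}\le\gamma}=\{\vec C_l\in\mathcal C^{l,\vec n}:\gamma_{p,q}(\vec C_l)\le\gamma\}$. Then for every sample $S=(\vec x_1,\dots,\vec x_m)$: (1) if $1\le p\le2$, $R_S(\mathcal F\circ\mathcal C^{l,\vec n}_{\gamma_{p,q}\le\gamma})\le\gamma\,4^{n_l\max\{1/p^*,1/q\}}\prod_{i=1}^{l-1}4^{n_i/p^*}\frac{\sqrt{\min\{p^*,8n_0\}}}{\sqrt m}K_p(S,H)$; (2) if $2<p<\infty$, $R_S(\mathcal F\circ\mathcal C^{l,\vec n}_{\gamma_{p,q}\le\gamma})\le\gamma\,4^{n_l\max\{1/p^*,1/q\}}\prod_{i=1}^{l-1}4^{n_i/p^*}\frac{\sqrt{p^*}}{m^{1/p}}K_p(S,H)$.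
   Context: Pauli notation $P_{\vec z}$ as tensor products of $P_0=\mathbb I,P_1=X,P_2=Y,P_3=Z$. Representation matrix of a linear map $\Phi$ from $a$ to $b$ qubits: $M^\Phi_{\vec z\vec x}=2^{-b}\mathrm{Tr}(P_{\vec z}\Phi(P_{\vec x}))$. $p^*$ is the Hölder conjugate. $\mathcal C^{l,\vec n}$ is the set of depth-$l$ circuits $\vec C_l=(\Phi_l,\dots,\Phi_1)$, $\Phi_i$ a quantum channel from $n_{i-1}$ to $n_i$ qubits, implementing $C_l=\Phi_l\circ\cdots\circ\Phi_1$. Path norm: for $\vec z\in\{0,1,2,3\}^{n_l}$, $\gamma^{(\vec z)}_p(\vec C_l)=\big(\sum_{v_0,\dots,v_{l-1}}|M^{\Phi_l}_{\vec zv_{l-1}}M^{\Phi_{l-1}}_{v_{l-1}v_{l-2}}\cdots M^{\Phi_1}_{v_1v_0}|^p\big)^{1/p}$, the sum over $v_i\in\{0,1,2,3\}^{n_i}$; $\gamma_{p,q}(\vec C_l)=\big(4^{-n_l}\sum_{\vec z}\gamma_p^{(\vec z)}(\vec C_l)^q\big)^{1/q}$ (for $q=\infty$, $\max_{\vec z}\gamma^{(\vec z)}_p(\vec C_l)$). Setup: data encoded as $n_0$-qubit pure states $\rho(\vec x)$, $H$ Hermitian on $n_l$ qubits, $f_{\vec C_l}(\vec x)=\mathrm{Tr}(C_l(\rho(\vec x))H)$; $R_S(\mathcal G)=\mathbb E_{\vec\epsilon}\frac1m\sup_{g\in\mathcal G}|\sum_i\epsilon_ig(\vec x_i)|$ with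 i.i.d. uniform signs. $\vec\alpha\in\mathbb R^{4^{n_l}}$ has entries $\mathrm{Tr}(P_{\vec z}H)$, $\vec f_I(\vec x)\in\mathbb R^{4^{n_0}}$ has entries $2^{-n_0}\mathrm{Tr}(P_{\vec z}\rho(\vec x))$, $K_p(S,H)=\|\vec\alpha\|_p\max_i\|\vec f_I(\vec x_i)\|_{p^*}$. *)

(* Defs.v *)
From mathcomp Require Import all_boot all_order all_algebra.
From mathcomp Require Import all_classical all_reals all_analysis.
From mathcomp.real_closed Require Import complex.
Unset Printing Implicit Defensive.
Import Order.TTheory GRing.Theory Num.Theory.
Local Open Scope ring_scope.

Section QDefs.
Variable R : realType.
Local Notation C := (R[i]).

Definition cabs (z : C) : R := complex.Re `|z|.

(* computational basis of n qubits, and operators (square complex matrices) on it *)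
Definition Qb (n : nat) := {ffun 'I_n -> bool}.
Definition Op (n : nat) := Qb n -> Qb n -> C.
Definition PIdx (n : nat) := {ffun 'I_n -> 'I_4}.

Definition trace {n} (A : Op n) : C := \sum_(s : Qb n) A s s.
Definition mulop {n} (A B : Op n) : Op n := fun s t => \sum_(u : Qb n) A s u * B u t.

(* single-qubit Paulis P_0 = I, P_1 = X, P_2 = Y, P_3 = Z ; basis false = |0>, true = |1> *)
Definition pauli1 (k : 'I_4) (s t : bool) : C :=
  match val k with
  | 0 => if s == t then 1 else 0
  | 1 => if s == t then 0 else 1
  | 2 => if s == t then 0 else (if s then 'i else - 'i)
  | _ => if s == t then (if s then -1 else 1) else 0
  end.

(* n-qubit Pauli string P_z = tensor product of the P_{z_k} (entries of the Kronecker product) *)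
Definition pauli {n} (z : PIdx n) : Op n := fun s t => \prod_(k < n) pauli1 (z k) (s k) (t k).

Definition psd {n} (A : Op n) : Prop :=
  forall v : Qb n -> C, 0 <= \sum_(s : Qb n) \sum_(t : Qb n) (v s)^* * A s t * v t.

Definition herm_op {n} (A : Op n) : Prop := forall s t, A s t = (A t s)^*.

Definition pure_state {n} (rho : Op n) : Prop :=
  exists v : Qb n -> C, \sum_s cabs (v s) ^+ 2 = 1 /\ forall s t, rho s t = v s * (v t)^*.

Definition linear_map {a b} (Phi : Op a -> Op b) : Prop :=
  forall (c : C) (X Y : Op a), Phi (fun s t => c * X s t + Y s t) =
                               (fun s t => c * Phi X s t + Phi Y s t).

Definition trace_preserving {a b} (Phi : Op a -> Op b) : Prop :=
  forall X : Op a, trace (Phi X) = trace X.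

(* Phi (x) id_k acting on operators of the system (qubits) x (k-dimensional ancilla) *)
Definition ext_id {a b} (Phi : Op a -> Op b) (k : nat)
    (X : Qb a * 'I_k -> Qb a * 'I_k -> C) : Qb b * 'I_k -> Qb b * 'I_k -> C :=
  fun st1 st2 => Phi (fun s s' => X (s, st1.2) (s', st2.2)) st1.1 st2.1.

Definition psd_gen {T : finType} (A : T -> T -> C) : Prop :=
  forall v : T -> C, 0 <= \sum_(s : T) \sum_(t : T) (v s)^* * A s t * v t.

Definition completely_positive {a b} (Phi : Op a -> Op b) : Prop :=
  forall (k : nat) (X : Qb a * 'I_k -> Qb a * 'I_k -> C),
    psd_gen X -> psd_gen (ext_id Phi k X).

Definition quantum_channel {a b} (Phi : Op a -> Op b) : Prop :=
  [/\ linear_map Phi, completely_positive Phi & trace_preserving Phi].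

Definition repmx {a b} (Phi : Op a -> Op b) (z : PIdx b) (x : PIdx a) : C :=
  (2 ^+ b)^-1 * trace (mulop (pauli z) (Phi (pauli x))).

(* A circuit: layer Phi i maps n i qubits to n i.+1 qubits (Phi i is Phi_{i+1} of the paper). *)
Variable n : nat -> nat.
Implicit Types (Phi : forall i : nat, Op (n i) -> Op (n i.+1)).

Fixpoint compose Phi (k : nat) : Op (n 0) -> Op (n k) :=
  match k return Op (n 0) -> Op (n k) with
  | 0 => fun X => X
  | k'.+1 => fun X => Phi k' (compose Phi k' X)
  end.

(* pathsum Phi p k v c = sum over v_{k-1},...,v_0 of
   |c * M^{Phi_k}_{v v_{k-1}} * ... * M^{Phi_1}_{v_1 v_0}|^p *)
Fixpoint pathsum Phi (p : R) (k : nat) : PIdx (n k) -> C -> R :=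
  match k return PIdx (n k) -> C -> R with
  | 0 => fun _ c => cabs c `^ p
  | k'.+1 => fun z c =>
      \sum_(v : PIdx (n k')) pathsum Phi p k' v (c * repmx (Phi k') z v)
  end.

Definition gamma_z Phi (p : R) (l : nat) (z : PIdx (n l)) : R :=
  pathsum Phi p l z 1 `^ p^-1.

Definition gamma_pq Phi (p : R) (q : \bar R) (l : nat) : R :=
  match q with
  | +oo%E => \big[Order.max/0]_(z : PIdx (n l)) gamma_z Phi p l z
  | r%:E => ((4 ^+ n l)^-1 * \sum_(z : PIdx (n l)) gamma_z Phi p l z `^ r) `^ r^-1
  | -oo%E => 0
  end.

End QDefs.
Arguments cabs {R}. Arguments trace {R n}. Arguments mulop {R n}. Arguments pauli {R n}.
Arguments psd {R n}. Arguments herm_op {R n}. Arguments pure_state {R n}.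
Arguments psd_gen {R T}. Arguments linear_map {R a b}. Arguments trace_preserving {R a b}.
Arguments ext_id {R a b}. Arguments completely_positive {R a b}.
Arguments quantum_channel {R a b}. Arguments repmx {R a b}.
Arguments compose {R n}. Arguments pathsum {R n}. Arguments gamma_z {R n}.
Arguments gamma_pq {R n}.

Definition hconj {R : realType} (p : R) : \bar R :=
  if p == 1 then +oo%E else (p / (p - 1))%:E.

Definition einv {R : realType} (r : \bar R) : R :=
  match r with r'%:E => r'^-1 | _ => 0 end.

Definition lpnorm {R : realType} {T : finType} (r : \bar R) (v : T -> R) : R :=
  match r with
  | +oo%E => \big[Order.max/0]_(z : T) `|v z|
  | r'%:E => (\sum_(z : T) `|v z| `^ r') `^ r'^-1
  | -oo%E => 0
  end.

Definition Kp {R : realType} {X : Type} {n0 nl m : nat} (rho : X -> Op R n0)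
    (H : Op R nl) (xs : 'I_m -> X) (p : R) : R :=
  lpnorm p%:E (fun z : PIdx nl => cabs (trace (mulop (pauli z) H))) *
  \big[Order.max/0]_(i < m)
     lpnorm (hconj p) (fun z : PIdx n0 =>
                         cabs ((2 ^+ n0)^-1 * trace (mulop (pauli z) (rho (xs i))))).

Definition rademacher {R : realType} {X : Type} (n : nat -> nat) {l m : nat}
    (rho : X -> Op R (n 0)) (H : Op R (n l)) (xs : 'I_m -> X)
    (p : R) (q : \bar R) (gam : R) : \bar R :=
  (\sum_(eps : {ffun 'I_m -> bool})
     ((2 ^+ m)^-1 * m%:R^-1)%:E *
     ereal_sup [set (cabs (\sum_(i < m) (if eps i then 1 else -1) *
                        trace (mulop (compose Phi l (rho (xs i))) H)))%R%:E
               | Phi in [set Phi : forall i : nat, Op R (n i) -> Op R (n i.+1) |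
                           (forall i, (i < l)%N -> quantum_channel (Phi i)) /\
                           (gamma_pq Phi p q l <= gam)%R]])%E.

(* Main.v *)
Require Import Defs.
From mathcomp Require Import all_boot all_order all_algebra.
From mathcomp Require Import all_classical all_reals all_analysis.
From mathcomp.real_closed Require Import complex.
From mathcomp Require Import ring lra.
Import Order.TTheory GRing.Theory Num.Theory.
Import numFieldNormedType.Exports.
Local Open Scope ring_scope.

(* Write r for the Hoelder conjugate of p.  Expand the operators in the Pauli
   basis.  The output of a circuit then is a sum over paths, and Hoelder's
   inequality, applied layer by layer, bounds |Tr (C(X) H)| by the p-path norms
   times the r-norm of the Pauli coefficients of X; an intermediate layer costs
   4^(n_i / r), the number of its Pauli indices to the power 1/r.  Taking
   X = sum_i eps_i rho(x_i) makes the bound uniform over circuits, so it remains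
   to average the r-norm of a Rademacher sum of vectors.  For r >= 2 this is
   Khintchine's inequality with constant sqrt r, from cosh x <= e^(x^2/2); for
   r <= 2 it is orthogonality of the signs and subadditivity of t^(r/2). *)

(** * Finite-dimensional Lp norms *)

Section LpNorms.
Variable R : realType.

Lemma powRV (x r : R) : 0 <= x -> (x^-1) `^ r = (x `^ r)^-1.
Proof. by move=> x0; rewrite -powR_inv1 // powRAC powR_inv1 ?powR_ge0. Qed.

Lemma powR_div (x y r : R) : 0 <= x -> 0 <= y -> (x / y) `^ r = x `^ r / y `^ r.
Proof.
by move=> x0 y0; rewrite powRM ?invr_ge0 // powRV.
Qed.

Lemma powRK {r x : R} : r != 0 -> 0 <= x -> (x `^ r) `^ r^-1 = x.
Proof. by move=> r0 x0; rewrite -powRrM mulfV // powRr1. Qed.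

(** Norms and inverse exponents take a default value at [-oo]; this splits a positive exponent into
    its two meaningful cases. *)
Lemma ereal_gt0_ind (P : \bar R -> Prop) :
  (forall r : R, 0 < r -> P r%:E) -> P +oo%E -> forall r, (0 < r)%E -> P r.
Proof.
move=> Pr Py [r| |]; [by rewrite lte_fin; exact: Pr | by []|].
by rewrite ltNge leNye.
Qed.

Variable T : finType.
Implicit Types (v a b : T -> R).

Lemma lpnorm_ge0 (r : \bar R) v : 0 <= lpnorm r v.
Proof. by case: r => [r| |] //=; [exact: powR_ge0|exact: bigmax_ge_id]. Qed.

Lemma le_lpnorm (r : \bar R) v w : (0 < r)%E ->
  (forall z, `|v z| <= `|w z|) -> lpnorm r v <= lpnorm r w.
Proof.
move=> r0 vw; elim/ereal_gt0_ind: r / r0 => [r r0|]; rewrite /lpnorm; last first.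
  by apply: le_bigmax2 => z _; exact: vw.
rewrite ge0_ler_powR ?nnegrE ?invr_ge0 ?(ltW r0) //;
  do ?by apply: sumr_ge0 => z _; exact: powR_ge0.
by apply: ler_sum => z _; rewrite ge0_ler_powR ?nnegrE ?normr_ge0 ?(ltW r0).
Qed.

Lemma powR_lpnorm (r : R) v : r != 0 ->
  lpnorm r%:E v `^ r = \sum_z `|v z| `^ r.
Proof.
move=> r0; rewrite /= -powRrM mulVf // powRr1 //; apply: sumr_ge0 => z _; exact: powR_ge0.
Qed.

Lemma norm_le_lpnorm (r : \bar R) v z : (0 < r)%E -> `|v z| <= lpnorm r v.
Proof.
move=> r0; elim/ereal_gt0_ind: r / r0 => [r r0|]; rewrite /lpnorm; last first.
  exact: (le_bigmax _ (fun z => `|v z|)).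
rewrite -[leLHS](powRK (lt0r_neq0 r0)) //.
rewrite ge0_ler_powR ?nnegrE ?invr_ge0 ?(ltW r0) ?powR_ge0 //.
  by rewrite sumr_ge0 // => ? _; rewrite powR_ge0.
by rewrite (bigD1 z) //= lerDl sumr_ge0 // => ? _; rewrite powR_ge0.
Qed.

Lemma einv_hconj (p : R) : 1 <= p -> einv (hconj p) = 1 - p^-1.
Proof.
rewrite le_eqVlt /hconj => /predU1P[<-|p1]; first by rewrite eqxx invr1 subrr.
rewrite (gt_eqF p1) /= invf_div mulrBl divff ?mul1r // gt_eqF //.
exact: lt_trans p1.
Qed.

Lemma hconj_gt0 (p : R) : 1 <= p -> (0 < hconj p)%E.
Proof.
rewrite le_eqVlt /hconj => /predU1P[<-|p1]; first by rewrite eqxx.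
by rewrite (gt_eqF p1) lte_fin divr_gt0 ?subr_gt0 // (lt_trans _ p1).
Qed.

(** Both vectors are scaled to norm 1 and Young's inequality [conjugate_powR] is summed over the
    coordinates. The case p = 1, where the conjugate is infinite, and the cases of a zero norm are
    settled first. *)
Lemma hoelder_lpnorm (p : R) a b : 1 <= p ->
  \sum_z `|a z * b z| <= lpnorm p%:E a * lpnorm (hconj p) b.
Proof.
rewrite le_eqVlt => /predU1P[<-|p1].
  rewrite /hconj eqxx /= invr1 powRr1; last first.
    by rewrite sumr_ge0 // => z _; rewrite powR_ge0.
  rewrite mulr_suml; apply: ler_sum => z _.
  by rewrite normrM powRr1 // ler_wpM2l //; exact: le_bigmax.
have p0 : 0 < p by exact: lt_trans p1.
have hq0 : (0 < hconj p)%E by apply: hconj_gt0; exact: ltW.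
have [A0|A0] := eqVneq (lpnorm p%:E a) 0.
  rewrite A0 mul0r big1 // => z _; apply/eqP; rewrite normr_eq0 mulf_eq0.
  by rewrite -normr_le0 -A0 norm_le_lpnorm.
have [B0|B0] := eqVneq (lpnorm (hconj p) b) 0.
  rewrite B0 mulr0 big1 // => z _; apply/eqP; rewrite normr_eq0 mulf_eq0.
  by rewrite orbC -normr_le0 -B0 norm_le_lpnorm.
move: hq0 B0 (einv_hconj _ (ltW p1)).
rewrite /hconj (gt_eqF p1); set q := p / (p - 1) => q0 B0 pq.
rewrite [einv _]/= in pq.
rewrite lte_fin in q0.
have sumE (r : R) (c : T -> R) : 0 < r -> 0 < lpnorm r%:E c ->
    \sum_z (`|c z| / lpnorm r%:E c) `^ r = 1.
  move=> rgt0 c0.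
  rewrite (eq_bigr (fun z => `|c z| `^ r / lpnorm r%:E c `^ r)) => [|z _]; last first.
    by apply: powR_div => //; exact: ltW.
  rewrite -mulr_suml -powR_lpnorm; last by rewrite gt_eqF.
  by rewrite mulfV // gt_eqF // powR_gt0.
have Agt0 : 0 < lpnorm p%:E a by rewrite lt_neqAle eq_sym A0 lpnorm_ge0.
have Bgt0 : 0 < lpnorm q%:E b by rewrite lt_neqAle eq_sym B0 lpnorm_ge0.
have := sumE _ _ q0 Bgt0; have := sumE _ _ p0 Agt0.
move: {sumE A0 B0} (lpnorm p%:E a) (lpnorm q%:E b) Agt0 Bgt0 => A B Agt0 Bgt0 sA sB.
rewrite -[leRHS]mulr1 -ler_pdivrMl; last exact: mulr_gt0.
rewrite mulr_sumr.
apply: (@le_trans _ _ (\sum_z ((`|a z| / A) `^ p / p + (`|b z| / B) `^ q / q))).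
  apply: ler_sum => z _.
  have -> : (A * B)^-1 * `|a z * b z| = (`|a z| / A) * (`|b z| / B).
    by rewrite normrM invfM mulrACA (mulrC A^-1) (mulrC B^-1).
  apply: conjugate_powR; [exact: divr_ge0 (ltW _)|exact: divr_ge0 (ltW _)|..] => //.
  by rewrite pq addrC subrK.
by rewrite big_split /= -!mulr_suml sA sB !mul1r pq addrC subrK.
Qed.

(** Hoelder's inequality against the constant vector 1. *)
Lemma sum_le_lpnorm (p : R) a : 1 <= p ->
  \sum_z `|a z| <= lpnorm p%:E a * #|T|%:R `^ einv (hconj p).
Proof.
move=> p1; have := @hoelder_lpnorm p a (fun=> 1) p1.
under eq_bigr do rewrite mulr1.
move=> /le_trans; apply; rewrite ler_wpM2l ?lpnorm_ge0 //.
rewrite /hconj; case: ifP => _ /=.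
  by rewrite powRr0; apply: bigmax_le => // z _; rewrite normr1.
by rewrite normr1 powR1 sumr_const.
Qed.

(** Monotonicity of power means. For finite s, apply [sum_le_lpnorm] with exponent s / r to |v|^r;
    for s = +oo, each entry is at most the maximum. *)
Lemma lpnorm_le_mean (r s : \bar R) v : (0 < r)%E -> (r <= s)%E ->
  lpnorm r v <= #|T|%:R `^ (einv r - einv s) * lpnorm s v.
Proof.
move=> r0; elim/ereal_gt0_ind: r / r0 => [r r0|]; last first.
  by rewrite leye_eq => /eqP ->; rewrite subrr powRr0 mul1r.
move=> rs; have s0 : (0 < s)%E by rewrite (lt_le_trans _ rs) ?lte_fin.
move: rs; elim/ereal_gt0_ind: s / s0 => [s _|_]; rewrite [einv _]/= [einv _]/=.
- rewrite lee_fin => rs; have s0 : 0 < s by exact: lt_le_trans rs.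
  have r1 : 0 <= r^-1 by rewrite invr_ge0 ltW.
  have h1 : 1 <= s / r by rewrite ler_pdivlMr // mul1r.
  have S0 (t : R) : 0 <= \sum_z `|v z| `^ t.
    by apply: sumr_ge0 => z _; exact: powR_ge0.
  have e1 : lpnorm (s / r)%:E (fun z => `|v z| `^ r) =
            (\sum_z `|v z| `^ s) `^ (r / s).
    rewrite /= invf_div; congr (_ `^ _); apply: eq_bigr => z _.
    rewrite (ger0_norm (powR_ge0 _ _)) -powRrM; congr (_ `^ _).
    by rewrite mulrCA mulfV ?mulr1 ?gt_eqF.
  have e2 : \sum_z `| `|v z| `^ r | = \sum_z `|v z| `^ r.
    by apply: eq_bigr => z _; exact: ger0_norm (powR_ge0 _ _).
  have := sum_le_lpnorm _ (fun z => `|v z| `^ r) h1.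
  rewrite e1 e2 (einv_hconj _ h1) invf_div.
  move/(ge0_ler_powR r1).
  rewrite !nnegrE S0 (mulr_ge0 (powR_ge0 _ _) (powR_ge0 _ _)).
  move=> /(_ isT isT) /le_trans; apply.
  rewrite (powRM _ (powR_ge0 _ _) (powR_ge0 _ _)) -!powRrM.
  rewrite mulrC mulrAC (mulfV (lt0r_neq0 r0)) mul1r.
  rewrite mulrBl mul1r mulrAC (mulfV (lt0r_neq0 r0)) mul1r.
  exact: lexx.
- rewrite subr0 [lpnorm +oo%E v]/=; set M := \big[_/_]_z _.
  have M0 : 0 <= M by exact: bigmax_ge_id.
  have vM z : `|v z| <= M by exact: (le_bigmax _ (fun z => `|v z|)).
  have <- : (M `^ r) `^ r^-1 = M by rewrite powRK ?gt_eqF.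
  rewrite -(powRM _ (ler0n _ _) (powR_ge0 _ _)).
  move: M M0 vM => M M0 vM.
  apply: ge0_ler_powR; rewrite ?nnegrE ?invr_ge0 ?(ltW r0) //.
  - by apply: sumr_ge0 => z _; exact: powR_ge0.
  - by apply: mulr_ge0; rewrite ?powR_ge0.
  rewrite mulr_natl -sumr_const; apply: ler_sum => z _.
  by apply: ge0_ler_powR; rewrite ?nnegrE ?(ltW r0) ?vM.
Qed.

(** For finite exponents, |v_z|^s = |v_z|^r |v_z|^(s-r), and the last factor is at most N^(s-r),
    where N is the r-norm. *)
Lemma lpnorm_antitone (r s : \bar R) v : (0 < r)%E -> (r <= s)%E ->
  lpnorm s v <= lpnorm r v.
Proof.
move=> r0 rs; have s0 := lt_le_trans r0 rs.
move: rs; elim/ereal_gt0_ind: s / s0 => [s s0|] rs.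
- move: rs; elim/ereal_gt0_ind: r / r0 => [r r0|]; last by rewrite leye_eq.
  rewrite lee_fin => rs.
  set N := lpnorm r%:E v.
  have N0 : 0 <= N by exact: lpnorm_ge0.
  suff : \sum_z `|v z| `^ s <= N `^ s.
    move=> h; rewrite -[leRHS](powRK (lt0r_neq0 s0) N0) /lpnorm.
    rewrite ge0_ler_powR ?nnegrE ?invr_ge0 ?(ltW s0) ?powR_ge0 //.
    by rewrite sumr_ge0 // => z _; rewrite powR_ge0.
  have split_s x : 0 <= x -> x `^ s = x `^ r * x `^ (s - r).
    move=> x0; have [->|xn0] := eqVneq x 0; last by rewrite -powRD ?xn0 ?implybT// subrKC.
    by rewrite (powR0 (lt0r_neq0 s0)) (powR0 (lt0r_neq0 r0)) mul0r.
  rewrite [leRHS]split_s // /N powR_lpnorm ?gt_eqF // mulr_suml.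
  apply: ler_sum => z _; rewrite split_s // ler_wpM2l ?powR_ge0 //.
  by rewrite ge0_ler_powR ?nnegrE ?subr_ge0 ?lpnorm_ge0 // norm_le_lpnorm ?lte_fin.
- by apply: bigmax_le => [|z _]; [exact: lpnorm_ge0|exact: norm_le_lpnorm].
Qed.

Lemma ler_einv (r s : \bar R) : (0 < r)%E -> (r <= s)%E -> einv s <= einv r.
Proof.
move=> r0 rs; have s0 := lt_le_trans r0 rs.
move: rs; elim/ereal_gt0_ind: s / s0 => [s s0|] rs.
  move: rs; elim/ereal_gt0_ind: r / r0 => [r r0|]; last by rewrite leye_eq.
  by rewrite lee_fin /= => rs; rewrite lef_pV2 // posrE.
by elim/ereal_gt0_ind: r / r0 rs => [r r0|] _ //=; rewrite invr_ge0 ltW.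
Qed.

(** The exponent is the positive part of 1/r - 1/s, so both orders of r and s are covered. With r =
    p* and s = q it is the source of max(1/p*, 1/q). *)
Lemma lpnorm_compare (r s : \bar R) v : (0 < r)%E -> (0 < s)%E ->
  lpnorm r v <= #|T|%:R `^ (Num.max (einv r) (einv s) - einv s) * lpnorm s v.
Proof.
move=> r0 s0; have [rs|/ltW sr] := leP r s.
  by rewrite max_l ?ler_einv //; exact: lpnorm_le_mean.
by rewrite max_r ?ler_einv // subrr powRr0 mul1r lpnorm_antitone.
Qed.

End LpNorms.

(** * Khintchine inequalities *)

Section Cosh.
Variable R : realType.

Lemma expRN_le (x : R) : 0 <= x -> expR (- x) <= expR x.
Proof. by move=> x0; rewrite ler_expR; lra. Qed.

Lemma is_derive_expRN (x : R) : is_derive x 1 (fun t : R => expR (- t)) (- expR (- x)).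
Proof.
have h := @is_derive1_comp R expR -%R x (expR (- x)) (-1) _ _.
rewrite -mulrN1; apply: h.
Qed.

(** The difference of the two sides vanishes at 0 and has derivative x (e^x - e^(-x)), which is
    nonnegative for x >= 0. *)
Lemma sinh_le_mul_cosh (x : R) : 0 <= x ->
  expR x - expR (- x) <= x * (expR x + expR (- x)).
Proof.
move=> x0; rewrite -subr_ge0.
pose F (t : R) := t * (expR t + expR (- t)) - (expR t - expR (- t)).
have dF (t : R) : is_derive t (1:R) F (t * (expR t - expR (- t))).
  have ? := is_derive_expRN t; apply: is_derive_eq.
  by rewrite /GRing.scale /=; ring.
have := @ger0_derive1_ndecry R F 0 _ _ _ 0 x (lexx 0) x0.
have -> : F 0 = 0 by rewrite /F mul0r oppr0 subrr subr0.
apply.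
- by move=> t _; apply: ex_derive.
- move=> t; rewrite in_itv /= andbT => t0.
  rewrite derive1E (@derive_val _ _ _ _ _ _ _ (dF t)).
  by rewrite mulr_ge0 ?(ltW t0) // subr_ge0 expRN_le // ltW.
- apply: continuous_subspaceT => t; apply: differentiable_continuous.
  by apply/derivable1_diffP; apply: ex_derive.
Qed.

(** Both sides are even. For x >= 0 the function 2 cosh(x) e^(-x^2/2) starts at 2 and is
    nonincreasing, its derivative having the sign of sinh x - x cosh x. *)
Lemma cosh_le_expR_sqr (x : R) : expR x + expR (- x) <= 2 * expR (x ^+ 2 / 2).
Proof.
wlog x0 : x / 0 <= x => [wh|].
  have [/wh//|/ltW] := leP 0 x.
  by rewrite -oppr_ge0 => /wh; rewrite opprK sqrrN addrC.
pose F (t : R) := (expR t + expR (- t)) * expR (- (t ^+ 2 / 2)).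
have dF (t : R) : is_derive t (1:R) F
    ((expR t - expR (- t) - t * (expR t + expR (- t))) * expR (- (t ^+ 2 / 2))).
  have ? := is_derive_expRN t.
  have h : is_derive t (1:R) (fun t : R => expR (- (t ^+ 2 / 2)))
      (expR (- (t ^+ 2 / 2)) * (- t)).
    apply: (@is_derive1_comp R expR (fun t : R => - (t ^+ 2 / 2)) t).
    apply: is_derive_eq.
    by rewrite /GRing.scale /=; field.
  apply: is_derive_eq.
  by rewrite /GRing.scale /=; ring.
have := @ler0_derive1_nincry R F 0 _ _ _ 0 x (lexx 0) x0.
have -> : F 0 = 2 by rewrite /F expr0n /= mul0r oppr0 expR0; ring.
rewrite /F (expRN (x ^+ 2 / 2)) ler_pdivrMr ?expR_gt0 //; apply.
- by move=> t _; apply: ex_derive.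
- move=> t; rewrite in_itv /= andbT => t0.
  rewrite derive1E (@derive_val _ _ _ _ _ _ _ (dF t)).
  by rewrite mulr_le0_ge0 ?expR_ge0 // subr_le0 sinh_le_mul_cosh // ltW.
- apply: continuous_subspaceT => t; apply: differentiable_continuous.
  by apply/derivable1_diffP; apply: ex_derive.
Qed.

End Cosh.

(** * Averages over random signs *)

Definition rsign {R : realType} (b : bool) : R := if b then 1 else -1.

Section Rademacher.
Variables (R : realType) (m : nat).
Implicit Types (f : 'I_m -> R) (F : {ffun 'I_m -> bool} -> R).

Definition average F : R := (2 ^+ m)^-1 * \sum_eps F eps.

Definition rsum f (eps : {ffun 'I_m -> bool}) : R := \sum_i rsign (eps i) * f i.

Lemma average_ge0 F : (forall eps, 0 <= F eps) -> 0 <= average F.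
Proof.
by move=> F0; apply: mulr_ge0; [rewrite invr_ge0 exprn_ge0|apply: sumr_ge0].
Qed.

Lemma ler_average F G : (forall eps, F eps <= G eps) -> average F <= average G.
Proof.
move=> FG; apply: ler_wpM2l; first by rewrite invr_ge0 exprn_ge0.
by apply: ler_sum => eps _; exact: FG.
Qed.

Lemma averageZ (c : R) F : average (fun eps => c * F eps) = c * average F.
Proof. by rewrite /average -mulr_sumr mulrCA. Qed.

Lemma averageD F G : average (fun eps => F eps + G eps) = average F + average G.
Proof. by rewrite /average big_split mulrDr. Qed.

Lemma average_sum (T : finType) (G : T -> {ffun 'I_m -> bool} -> R) :
  average (fun eps => \sum_z G z eps) = \sum_z average (G z).
Proof. by rewrite /average exchange_big mulr_sumr. Qed.

(** Independence of the signs: distributing a product of two-term sums yields the sum over all sign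
    vectors. *)
Lemma average_prod (G : 'I_m -> bool -> R) :
  average (fun eps => \prod_i G i (eps i)) = \prod_i ((G i true + G i false) / 2).
Proof.
rewrite /average -(bigA_distr_bigA (fun i b => G i b)) big_split /= prodr_const.
rewrite card_ord exprVn mulrC; congr (_ * _).
by apply: eq_bigr => i _; rewrite big_bool.
Qed.

(** Jensen's inequality for t^r, obtained by comparing the 1-norm and the r-norm on the space of
    sign vectors. *)
Lemma powR_average_le F (r : R) : 1 <= r -> (forall eps, 0 <= F eps) ->
  average F `^ r <= average (fun eps => F eps `^ r).
Proof.
move=> r1 F0; have r0 : 0 < r by exact: lt_le_trans r1.
have := @lpnorm_le_mean R {ffun 'I_m -> bool} (1:R)%:E r%:E F lte01.
rewrite lee_fin => /(_ r1).
have -> : lpnorm (1:R)%:E F = \sum_eps F eps.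
  rewrite /= invr1 powRr1; last by apply: sumr_ge0 => z _; exact: powR_ge0.
  by apply: eq_bigr => z _; rewrite powRr1 ger0_norm.
rewrite card_ffun card_bool card_ord natrX.
set N : R := 2 ^+ m; have N0 : 0 < N by exact: exprn_gt0.
have Nn0 : N != 0 by exact: lt0r_neq0.
have Sr : lpnorm r%:E F `^ r = \sum_eps F eps `^ r.
  rewrite powR_lpnorm ?lt0r_neq0 //.
  by apply: eq_bigr => z _; rewrite ger0_norm.
have S0 : 0 <= \sum_eps F eps by exact: sumr_ge0.
move/(ge0_ler_powR (ltW r0)); rewrite !nnegrE S0.
rewrite (mulr_ge0 (powR_ge0 _ _) (lpnorm_ge0 _ _ _ _)) => /(_ isT isT).
rewrite (powRM _ (powR_ge0 _ _) (lpnorm_ge0 _ _ _ _)) Sr -powRrM.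
rewrite -[einv r%:E]/(r^-1) -[einv 1%:E]/(1^-1) mulrBl invr1 mul1r (mulVf (lt0r_neq0 r0)) => h.
rewrite /average -/N (powRM _ _ S0) ?invr_ge0 ?(ltW N0) //.
(* The powers of N = 2^m combine as N^(-r) N^(r-1) = N^(-1), the weight of the average. *)
apply: (@le_trans _ _ (N^-1 `^ r * (N `^ (r - 1) * \sum_eps F eps `^ r))).
  exact: (ler_wpM2l (powR_ge0 _ _) h).
rewrite mulrA -(powR_inv1 (ltW N0)) -powRrM -powRD ?Nn0 ?implybT //.
by rewrite mulN1r addrA addNr add0r.
Qed.

(** By independence the average factors into the terms cosh(a f_i), each bounded by
    [cosh_le_expR_sqr]: the sum is sub-Gaussian. *)
Lemma average_expR f (a : R) :
  average (fun eps => expR (a * rsum f eps)) <= expR (a ^+ 2 * (\sum_i f i ^+ 2) / 2).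
Proof.
rewrite (_ : average _ = average (fun eps =>
    \prod_i expR (a * (rsign (eps i) * f i)))); last first.
  congr average; apply: boolp.funext => eps.
  by rewrite /rsum mulr_sumr expR_sum.
rewrite (average_prod (fun i b => expR (a * (rsign b * f i)))).
rewrite mulr_sumr mulr_suml expR_sum; apply: ler_prod => i _.
rewrite divr_ge0 ?addr_ge0 ?expR_ge0 //=.
rewrite /rsign mul1r mulN1r mulrN ler_pdivrMr // [leRHS]mulrC -exprMn.
exact: cosh_le_expR_sqr.
Qed.

(* This is y^r <= e^(r (y - 1)) at y = a x / r. *)
Lemma powR_le_expR (r a x : R) : 0 < r -> 0 < a -> 0 <= x ->
  x `^ r <= (r / a) `^ r * (expR (- r) * expR (a * x)).
Proof.
move=> r0 a0 x0.
have y0 : 0 <= a * x / r by rewrite divr_ge0 ?mulr_ge0 ?(ltW a0) ?(ltW r0).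
have ra : 0 <= r / a by rewrite divr_ge0 ?(ltW a0) ?(ltW r0).
have {1}-> : x = (r / a) * (a * x / r).
  by field; rewrite !gt_eqF.
rewrite powRM // ler_wpM2l ?powR_ge0 //.
rewrite -expRD (_ : - r + a * x = (a * x / r - 1) * r); last first.
  by field; rewrite gt_eqF.
rewrite expRM ge0_ler_powR ?nnegrE ?(ltW r0) ?expR_ge0 //.
by have := expR_ge1Dx (a * x / r - 1); rewrite addrC subrK.
Qed.

(** By [powR_le_expR], |S|^r is controlled by e^(a|S|), whose average [average_expR] bounds. If all
    f_i are 0 both sides vanish, so a may be scaled by the sum of squares. *)
Lemma khintchine_ge2 f (r : R) : 2 <= r ->
  average (fun eps => `|rsum f eps| `^ r) <= (r * \sum_i f i ^+ 2) `^ (r / 2).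
Proof.
move=> r2; have r0 : 0 < r by lra.
set s2 := \sum_i f i ^+ 2.
have s20 : 0 <= s2 by apply: sumr_ge0 => i _; exact: sqr_ge0.
have [s2z|s2n] := eqVneq s2 0.
  rewrite s2z mulr0 powR0 ?gt_eqF ?divr_gt0 // /average big1 ?mulr0 // => eps _.
  rewrite /rsum big1 ?normr0 ?powR0 ?gt_eqF // => i _.
  have /eqP := s2z; rewrite psumr_eq0; last by move=> j _; exact: sqr_ge0.
  by move=> /allP /(_ i (mem_index_enum _)) /=; rewrite sqrf_eq0 => /eqP ->; rewrite mulr0.
have {}s20 : 0 < s2 by rewrite lt_neqAle eq_sym s2n.
(* This a minimizes the exponential bound below; it makes a^2 s2 / 2 = r / 2. *)
pose a := Num.sqrt (r / s2).
have a0 : 0 < a by rewrite sqrtr_gt0 divr_gt0.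
have a2 : a ^+ 2 = r / s2 by rewrite sqr_sqrtr // divr_ge0 ?ltW.
have ra : (r / a) ^+ 2 = r * s2.
  by rewrite expr_div_n a2; field; rewrite s2n gt_eqF.
have rar : (r / a) `^ r = (r * s2) `^ (r / 2).
  rewrite -ra -powR_mulrn ?divr_ge0 ?ltW // -powRrM; congr (_ `^ _).
  by field.
have step eps : `|rsum f eps| `^ r <= (r * s2) `^ (r / 2) * (expR (- r) *
     (expR (a * rsum f eps) + expR (- a * rsum f eps))).
  apply: (le_trans (powR_le_expR r a _ r0 a0 (normr_ge0 _))).
  rewrite rar ler_wpM2l ?powR_ge0 // ler_wpM2l ?expR_ge0 //.
  (* |S| is S or -S, so e^(a|S|) is at most e^(aS) + e^(-aS). *)
  have [h|h] := leP 0 (rsum f eps).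
    by rewrite ger0_norm // lerDl expR_ge0.
  by rewrite ltr0_norm // mulrN -mulNr lerDr expR_ge0.
apply: (le_trans (ler_average _ _ step)).
rewrite !averageZ averageD -[leRHS]mulr1 ler_wpM2l ?powR_ge0 //.
have e1 := average_expR f a; have e2 := average_expR f (- a).
rewrite sqrrN -/s2 a2 divfK // in e1 e2.
apply: (@le_trans _ _ (expR (- r) * (expR (r / 2) + expR (r / 2)))).
  by rewrite ler_wpM2l ?expR_ge0 // lerD.
(* What remains is 2 e^(-r/2) <= 1, from e^(r/2) >= 1 + r/2 >= 2. *)
have er : expR r = expR (r / 2) * expR (r / 2) by rewrite -expRD -splitr.
rewrite expRN ler_pdivrMl ?expR_gt0 // mulr1 er.
have := expR_ge1Dx (r / 2); have := expR_gt0 (r / 2).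
by set x := expR _ => x0 x1; nra.
Qed.

(** The signs are orthonormal, so only the diagonal of the expanded square survives. *)
Lemma average_rsum_sqr f : average (fun eps => rsum f eps ^+ 2) = \sum_i f i ^+ 2.
Proof.
have cross i j : average (fun eps => rsign (eps i) * rsign (eps j)) = (i == j)%:R.
  have [<-|ij] := eqVneq i j.
    rewrite /average (eq_bigr (fun=> 1)) => [|eps _]; last first.
      by rewrite /rsign; case: (eps i); rewrite ?mulr1 ?mulrNN ?mulr1.
    by rewrite sumr_const card_ffun card_bool card_ord natrX mulVf // expf_neq0.
  (* This writes the product of two distinct signs as a product over all indices, so that
     [average_prod] applies; the factor at i averages to 0. *)
  pose G (k : 'I_m) (b : bool) : R := if (k == i) || (k == j) then rsign b else 1.
  rewrite (_ : average _ = average (fun eps => \prod_k G k (eps k))); last first.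
    congr average; apply: boolp.funext => eps.
    rewrite (bigD1 i) //= (bigD1 j) 1?eq_sym //= big1 => [|k /andP[ki kj]].
      by rewrite mulr1 /G !eqxx orbT.
    by rewrite /G (negPf ki) (negPf kj).
  by rewrite average_prod (bigD1 i) //= /G eqxx /= addrN mul0r mul0r.
rewrite (_ : average _ = average (fun eps =>
    \sum_i \sum_j (f i * f j) * (rsign (eps i) * rsign (eps j)))); last first.
  congr average; apply: boolp.funext => eps; rewrite expr2 /rsum mulr_suml.
  by apply: eq_bigr => i _; rewrite mulr_sumr; apply: eq_bigr => j _; ring.
rewrite average_sum; apply: eq_bigr => i _.
rewrite average_sum (bigD1 i) //= averageZ cross eqxx mulr1 big1 ?addr0 ?expr2 //.
by move=> j ji; rewrite averageZ cross eq_sym (negPf ji) mulr0.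
Qed.

(** Jensen's inequality with exponent 2 / r >= 1 passes from |S|^r to S^2, whose average is known
    exactly. *)
Lemma khintchine_le2 f (r : R) : 0 < r -> r <= 2 ->
  average (fun eps => `|rsum f eps| `^ r) <= (\sum_i f i ^+ 2) `^ (r / 2).
Proof.
move=> r0 r2; rewrite -average_rsum_sqr.
have h1 : 1 <= 2 / r by rewrite ler_pdivlMr // mul1r.
have e2 : average (fun eps => (`|rsum f eps| `^ r) `^ (2 / r)) =
    average (fun eps => rsum f eps ^+ 2).
  congr average; apply: boolp.funext => eps.
  by rewrite -powRrM mulrCA mulfV ?gt_eqF // mulr1 powR_mulrn // real_normK // num_real.
have := powR_average_le (fun eps => `|rsum f eps| `^ r) (2 / r) h1 (fun eps => powR_ge0 _ _).
rewrite e2.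
have r20 : 0 <= r / 2 by rewrite divr_ge0 // ltW.
have A0 : 0 <= average (fun eps => `|rsum f eps| `^ r).
  by apply: average_ge0 => eps; exact: powR_ge0.
have B0 : 0 <= average (fun eps => rsum f eps ^+ 2).
  by apply: average_ge0 => eps; exact: sqr_ge0.
move/(ge0_ler_powR r20); rewrite !nnegrE powR_ge0 B0 => /(_ isT isT).
rewrite -powRrM (_ : 2 / r * (r / 2) = 1) ?powRr1 //.
by field; rewrite gt_eqF.
Qed.

(** * Rademacher sums of vectors *)

Section Vectors.
Variables (T : finType) (f : 'I_m -> T -> R) (K : R).

(** Jensen's inequality moves the r-th power inside the average, where it splits the norm into
    coordinates that a scalar Khintchine bound can handle. *)
Lemma average_lpnorm_le (r : R) : 1 <= r ->
  average (fun eps => lpnorm r%:E (fun z => rsum (f ^~ z) eps)) <=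
  (\sum_z average (fun eps => `|rsum (f ^~ z) eps| `^ r)) `^ r^-1.
Proof.
move=> r1; have r0 : 0 < r by exact: lt_le_trans r1.
set N := fun eps => lpnorm r%:E (fun z => rsum (f ^~ z) eps).
have N0 eps : 0 <= N eps by exact: lpnorm_ge0.
have A0 : 0 <= average N by exact: average_ge0.
have := powR_average_le N r r1 N0.
rewrite (_ : average (fun eps => N eps `^ r) =
    \sum_z average (fun eps => `|rsum (f ^~ z) eps| `^ r)); last first.
  rewrite -average_sum; congr average; apply: boolp.funext => eps.
  by rewrite /N powR_lpnorm // gt_eqF.
move: (\sum_z _) => S h.
have S0 : 0 <= S by apply: le_trans h; exact: powR_ge0.
have ri : 0 <= r^-1 by rewrite invr_ge0 ltW.
move: h => /(ge0_ler_powR ri); rewrite !nnegrE powR_ge0 S0 => /(_ isT isT).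
by rewrite powRK ?gt_eqF.
Qed.

Lemma sum_powR_le_lpnorm (r : R) i : 0 < r -> lpnorm r%:E (f i) <= K ->
  \sum_z `|f i z| `^ r <= K `^ r.
Proof.
move=> r0 fK; rewrite -powR_lpnorm ?gt_eqF //.
apply: ge0_ler_powR; rewrite ?nnegrE ?lpnorm_ge0 ?(ltW r0) //.
exact: le_trans (lpnorm_ge0 _ _ _ _) fK.
Qed.

(** Khintchine's inequality in each coordinate leaves (sum_i f_i(z)^2)^(r/2); [msq] trades it for
    r-th powers, which regroup into the r-norms of the vectors f_i. *)
Lemma average_lpnorm_ge2 (r : R) : 2 <= r -> (0 < m)%N ->
  (forall i, lpnorm r%:E (f i) <= K) ->
  average (fun eps => lpnorm r%:E (fun z => rsum (f ^~ z) eps)) <=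
  Num.sqrt r * Num.sqrt m%:R * K.
Proof.
move=> r2 m0 fK; have r0 : 0 < r by lra.
have r1 : 1 <= r by lra.
have K0 : 0 <= K by exact: le_trans (lpnorm_ge0 _ _ _ _) (fK (Ordinal m0)).
have mR : 0 < m%:R :> R by rewrite ltr0n.
(* Power mean over the m samples with exponent r / 2 >= 1, whence the factor m^(r/2 - 1). *)
have msq z : (\sum_i f i z ^+ 2) `^ (r / 2) <=
    m%:R `^ (r / 2) / m%:R * \sum_i `|f i z| `^ r.
  have r21 : 1 <= r / 2 by rewrite ler_pdivlMr // mul1r.
  have := @lpnorm_le_mean R 'I_m (1:R)%:E (r / 2)%:E (fun i => f i z ^+ 2) lte01.
  rewrite lee_fin => /(_ r21).
  have -> : lpnorm (1:R)%:E (fun i => f i z ^+ 2) = \sum_i f i z ^+ 2.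
    rewrite /= invr1 powRr1; last by apply: sumr_ge0 => i _; exact: powR_ge0.
    by apply: eq_bigr => i _; rewrite powRr1 ger0_norm ?sqr_ge0.
  have r20 : 0 < r / 2 by rewrite divr_gt0.
  have S0 : 0 <= \sum_i f i z ^+ 2 by apply: sumr_ge0 => i _; exact: sqr_ge0.
  move/(ge0_ler_powR (ltW r20)); rewrite !nnegrE S0.
  rewrite (mulr_ge0 (powR_ge0 _ _) (lpnorm_ge0 _ _ _ _)) => /(_ isT isT).
  rewrite (powRM _ (powR_ge0 _ _) (lpnorm_ge0 _ _ _ _)) -powRrM.
  rewrite (powR_lpnorm _ _ _ _ (lt0r_neq0 r20)) card_ord.
  rewrite -[einv (r / 2)%:E]/((r / 2)^-1) -[einv 1%:E]/(1^-1) invr1.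
  rewrite mulrBl mul1r (mulVf (lt0r_neq0 r20)).
  rewrite powRB ?(gt_eqF mR) ?implybT // (powRr1 (ltW mR)).
  move=> /le_trans; apply; rewrite ler_wpM2l ?divr_ge0 ?powR_ge0 ?(ltW mR) //.
  apply: ler_sum => i _.
  rewrite normrX -powR_mulrn // -powRrM (_ : 2 * (r / 2) = r) //.
  by field.
apply: le_trans (average_lpnorm_le r r1) _.
have B0 : 0 <= Num.sqrt r * Num.sqrt m%:R * K.
  by rewrite !mulr_ge0 ?sqrtr_ge0.
rewrite -[leRHS](powRK _ (lt0r_neq0 r0) B0).
apply: ge0_ler_powR; rewrite ?nnegrE ?invr_ge0 ?(ltW r0) ?powR_ge0 //.
  by apply: sumr_ge0 => z _; apply: average_ge0 => eps; exact: powR_ge0.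
apply: (@le_trans _ _ (\sum_z r `^ (r / 2) * (m%:R `^ (r / 2) / m%:R *
    \sum_i `|f i z| `^ r))).
  apply: ler_sum => z _; apply: le_trans (khintchine_ge2 _ r r2) _.
  rewrite (powRM _ (ltW r0)); last by apply: sumr_ge0 => i _; exact: sqr_ge0.
  by rewrite ler_wpM2l ?powR_ge0.
rewrite -!mulr_sumr exchange_big /=.
rewrite powRM ?mulr_ge0 ?sqrtr_ge0 // powRM ?sqrtr_ge0 //.
rewrite -(powR12_sqrt (ltW r0)) -(powR12_sqrt (ltW mR)) -!powRrM (mulrC 2^-1).
rewrite -[leRHS]mulrA ler_wpM2l ?powR_ge0 // -[leLHS]mulrA ler_wpM2l ?powR_ge0 //.
(* Each of the m vectors contributes at most K^r, which cancels the division by m. *)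
rewrite ler_pdivrMl // mulr_natl -[X in _ *+ X]card_ord -sumr_const.
by apply: ler_sum => i _; exact: sum_powR_le_lpnorm.
Qed.

(** As r <= 2, the 2-norm over the samples is at most the r-norm, so the Khintchine bound in
    coordinate z is at most sum_i |f_i(z)|^r; the sum over z is at most m K^r. *)
Lemma average_lpnorm_le2 (r : R) : 1 <= r -> r <= 2 -> (0 < m)%N ->
  (forall i, lpnorm r%:E (f i) <= K) ->
  average (fun eps => lpnorm r%:E (fun z => rsum (f ^~ z) eps)) <=
  m%:R `^ r^-1 * K.
Proof.
move=> r1 r2 m0 fK; have r0 : 0 < r by lra.
have K0 : 0 <= K by exact: le_trans (lpnorm_ge0 _ _ _ _) (fK (Ordinal m0)).
apply: le_trans (average_lpnorm_le r r1) _.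
have <- : (K `^ r) `^ r^-1 = K by rewrite powRK ?gt_eqF.
rewrite -(powRM _ (ler0n _ _) (powR_ge0 _ _)).
apply: ge0_ler_powR; rewrite ?nnegrE ?invr_ge0 ?(ltW r0) ?mulr_ge0 ?powR_ge0 //.
  by apply: sumr_ge0 => z _; apply: average_ge0 => eps; exact: powR_ge0.
apply: (@le_trans _ _ (\sum_z \sum_i `|f i z| `^ r)).
  apply: ler_sum => z _; apply: le_trans (khintchine_le2 _ r r0 r2) _.
  have := @lpnorm_antitone R 'I_m r%:E (2:R)%:E (f ^~ z).
  rewrite lte_fin lee_fin => /(_ r0 r2) /(ge0_ler_powR (ltW r0)).
  rewrite !nnegrE => /(_ (lpnorm_ge0 _ _ _ _) (lpnorm_ge0 _ _ _ _)).
  rewrite (powR_lpnorm _ _ r _ (lt0r_neq0 r0)).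
  rewrite /lpnorm -powRrM (mulrC 2^-1).
  rewrite (eq_bigr (fun i => f i z ^+ 2)) // => i _.
  by rewrite powR_mulrn // real_normK // num_real.
rewrite exchange_big /= mulr_natl -[X in _ *+ X]card_ord -sumr_const.
by apply: ler_sum => i _; exact: sum_powR_le_lpnorm.
Qed.

End Vectors.

End Rademacher.

(** * Pauli expansion *)

Section ComplexModulus.
Variable R : realType.
Implicit Types z w : R[i].

Lemma cabsE z : (cabs z)%:C%C = `|z|.
Proof. by rewrite /cabs RRe_real // normr_real. Qed.

Lemma cabs_ge0 z : 0 <= cabs z.
Proof. by rewrite -lecR cabsE normr_ge0. Qed.

Lemma cabsM z w : cabs (z * w) = cabs z * cabs w.
Proof.
by apply: (@complexI R); rewrite rmorphM /= !cabsE normrM.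
Qed.

Lemma cabs_sum (I : finType) (F : I -> R[i]) :
  cabs (\sum_i F i) <= \sum_i cabs (F i).
Proof.
rewrite -lecR cabsE rmorph_sum; apply: le_trans (ler_norm_sum _ _ _) _.
by apply: ler_sum => i _; rewrite -cabsE.
Qed.

Lemma cabs_real (x : R) : cabs (x%:C%C) = `|x|.
Proof.
by rewrite /cabs normc_def /= expr0n /= addr0 sqrtr_sqr.
Qed.

End ComplexModulus.

Section PauliExpansion.
Variable R : realType.
Local Notation C := R[i].

(** Up to the factor 2, the sum of P_k tensor P_k is the swap of two qubits; all sixteen entries are
    checked. *)
Lemma pauli1_complete (a b c d : bool) :
  \sum_(k < 4) pauli1 R k a b * pauli1 R k c d = 2 * ((a == d) && (b == c))%:R.
Proof.
rewrite !big_ord_recl big_ord0 /pauli1 /=.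
have ii : 'i * 'i = -1 :> C by rewrite -expr2 sqrCi.
by case: a; case: b; case: c; case: d; rewrite /= ?mulrN ?mulNr ?ii; ring.
Qed.

(** The sum over strings factors into one single-qubit sum per position; a position where the
    indices disagree gives a factor 0. *)
Lemma pauli_complete (n : nat) (s t u w : Qb n) :
  \sum_z pauli z s t * pauli z u w = 2 ^+ n * ((s == w) && (t == u))%:R :> C.
Proof.
rewrite /pauli; under eq_bigr do rewrite -big_split /=.
rewrite -(bigA_distr_bigA (fun k j => pauli1 R j (s k) (t k) * pauli1 R j (u k) (w k))) /=.
under eq_bigr do rewrite pauli1_complete.
rewrite big_split /= prodr_const card_ord; congr (_ * _).
case: (boolP ((s == w) && (t == u))) => [/andP[/eqP <- /eqP <-]|].
  by rewrite big1 // => k _; rewrite !eqxx.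
move=> h.
have [k hk] : exists k, ~~ ((s k == w k) && (t k == u k)).
  apply/existsP; apply: contraNT h => /existsPn h.
  apply/andP; split; apply/eqP/ffunP => k;
    by have := h k; rewrite negbK => /andP[/eqP ? /eqP ?].
by rewrite (bigD1 k) //= (negPf hk) mul0r.
Qed.

(** Normalized so that [repmx Phi z x] is by definition [pcoef (Phi (pauli x)) z], and the
    coefficients of an input state are the entries of f_I. *)
Definition pcoef {n} (X : Op R n) (z : PIdx n) : C :=
  (2 ^+ n)^-1 * trace (mulop (pauli z) X).

(** By completeness the double sum in the trace collapses to the single term u = t, w = s. *)
Lemma pauli_expansion (n : nat) (X : Op R n) :
  X = fun s t => \sum_z pcoef X z * pauli z s t.
Proof.
apply: boolp.funext => s; apply: boolp.funext => t.
rewrite /pcoef /trace /mulop.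
under eq_bigr => z _ do rewrite -mulrA mulr_suml.
rewrite -mulr_sumr exchange_big /=.
under eq_bigr => u _.
  under eq_bigr => z _ do rewrite mulr_suml.
  rewrite exchange_big /=.
  under eq_bigr => w _.
    under eq_bigr => z _ do rewrite mulrAC.
    rewrite -mulr_suml pauli_complete.
    over.
  over.
rewrite (bigD1 t) //= [X in _ + X]big1 ?addr0; last first.
  move=> u ut; rewrite big1 // => w _; rewrite (negPf ut) /=.
  by rewrite mulr0 mul0r.
rewrite (bigD1 s) //= [X in _ + X]big1 ?addr0; last first.
  by move=> w ws; rewrite (negPf ws) andbF mulr0 mul0r.
by rewrite !eqxx mulr1 mulrA mulVf ?mul1r // expf_neq0.
Qed.

Lemma trace_mulop_suml (n : nat) (I : finType) (c : I -> C) (Y : I -> Op R n) (H : Op R n) :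
  trace (mulop (fun s t => \sum_i c i * Y i s t) H) =
  \sum_i c i * trace (mulop (Y i) H).
Proof.
rewrite /trace /mulop; under [RHS]eq_bigr do rewrite mulr_sumr.
rewrite [RHS]exchange_big; apply: eq_bigr => s _ /=.
under [RHS]eq_bigr do rewrite mulr_sumr.
rewrite [RHS]exchange_big; apply: eq_bigr => t _ /=.
by rewrite mulr_suml; apply: eq_bigr => i _; rewrite mulrA.
Qed.

Lemma trace_mulopC (n : nat) (A B : Op R n) : trace (mulop A B) = trace (mulop B A).
Proof.
rewrite /trace /mulop exchange_big; apply: eq_bigr => s _ /=.
by apply: eq_bigr => t _; rewrite mulrC.
Qed.

Lemma trace_mulop_pauli (n : nat) (X H : Op R n) :
  trace (mulop X H) = \sum_z pcoef X z * trace (mulop (pauli z) H).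
Proof. by rewrite {1}(pauli_expansion _ X) trace_mulop_suml. Qed.

Lemma pcoef_sum (n : nat) (I : finType) (c : I -> C) (Y : I -> Op R n) (z : PIdx n) :
  pcoef (fun s t => \sum_i c i * Y i s t) z = \sum_i c i * pcoef (Y i) z.
Proof.
rewrite /pcoef trace_mulopC trace_mulop_suml mulr_sumr.
by apply: eq_bigr => i _; rewrite mulrCA trace_mulopC.
Qed.

Lemma linear_map_sum (a b : nat) (Phi : Op R a -> Op R b) (I : finType) (c : I -> C)
    (Y : I -> Op R a) : linear_map Phi ->
  Phi (fun s t => \sum_i c i * Y i s t) = fun s t => \sum_i c i * Phi (Y i) s t.
Proof.
move=> lin; elim: (index_enum I) => [|i r IH].
  (* For the empty sum, linearity at 0 = -1 * 0 + 0 gives Phi(0) = - Phi(0) + Phi(0) = 0. *)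
  have -> : (fun s t : Qb a => \sum_(i <- [::]) c i * Y i s t) =
      (fun s t => -1 * 0 + 0).
    by apply: boolp.funext => s; apply: boolp.funext => t; rewrite big_nil mulr0 addr0.
  rewrite (lin (-1) (fun _ _ => 0) (fun _ _ => 0)).
  apply: boolp.funext => s; apply: boolp.funext => t.
  by rewrite big_nil mulN1r addNr.
have -> : (fun s t : Qb a => \sum_(j <- i :: r) c j * Y j s t) =
    (fun s t => c i * Y i s t + \sum_(j <- r) c j * Y j s t).
  by apply: boolp.funext => s; apply: boolp.funext => t; rewrite big_cons.
rewrite (lin (c i) (Y i)) IH.
by apply: boolp.funext => s; apply: boolp.funext => t; rewrite big_cons.
Qed.

(** Applied once per layer, this turns a circuit into a sum over paths. *)
Lemma pcoef_linear_map (a b : nat) (Phi : Op R a -> Op R b) (X : Op R a) (z : PIdx b) :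
  linear_map Phi -> pcoef (Phi X) z = \sum_v repmx Phi z v * pcoef X v.
Proof.
move=> lin; rewrite {1}(pauli_expansion _ X) (linear_map_sum _ _ _ _ _ _ lin) pcoef_sum.
by apply: eq_bigr => v _; rewrite mulrC.
Qed.

Lemma pauli_herm (n : nat) (z : PIdx n) : herm_op (pauli z : Op R n).
Proof.
move=> s t; rewrite /pauli rmorph_prod; apply: eq_bigr => k _.
rewrite /pauli1; case: (val (z k)) => [|[|[|_]]];
  case: (s k); case: (t k); rewrite /= ?rmorphN ?rmorph0 ?rmorph1 /= ?conjCi ?opprK //.
Qed.

(** The trace of a product of two Hermitian operators is real. Hence signed sums of state
    coefficients are real Rademacher sums. *)
Lemma pcoef_herm_real (n : nat) (X : Op R n) (z : PIdx n) : herm_op X ->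
  pcoef X z = (complex.Re (pcoef X z))%:C%C.
Proof.
move=> hX; rewrite RRe_real //; apply/CrealP.
rewrite /pcoef rmorphM fmorphV rmorphXn /= conjC_nat; congr (_ * _).
rewrite [RHS]trace_mulopC /trace /mulop rmorph_sum; apply: eq_bigr => s _.
rewrite rmorph_sum; apply: eq_bigr => t _.
by rewrite rmorphM mulrC /= -hX -pauli_herm.
Qed.

Lemma pure_state_herm (n : nat) (X : Op R n) : pure_state X -> herm_op X.
Proof. by move=> [v [_ vX]] s t; rewrite !vX rmorphM /= conjCK mulrC. Qed.

End PauliExpansion.

(** * Path norms *)

Section Circuits.
Variables (R : realType) (n : nat -> nat).
Implicit Types (Phi : forall i : nat, Op R (n i) -> Op R (n i.+1)).

Lemma card_PIdx (k : nat) : #|PIdx k| = (4 ^ k)%N.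
Proof. by rewrite card_ffun !card_ord. Qed.

Lemma powR_card_PIdx (k : nat) (e : R) :
  #|PIdx k|%:R `^ e = 4 `^ (k%:R * e).
Proof. by rewrite card_PIdx natrX powRrM powR_mulrn. Qed.

Lemma linear_map_compose Phi (k : nat) :
  (forall i, (i < k)%N -> linear_map (Phi i)) -> linear_map (compose Phi k).
Proof.
elim: k => [|k IH] lin c X Y //=.
rewrite IH ?lin // => i ik; apply: lin; exact: leqW.
Qed.

Lemma pathsum_ge0 Phi p k (z : PIdx (n k)) c : 0 <= pathsum Phi p k z c.
Proof.
elim: k z c => [|k IH] z c /=; first exact: powR_ge0.
by apply: sumr_ge0 => v _; exact: IH.
Qed.

(** Induction on the depth, peeling off the last layer; c carries the product of the matrix entries
    already chosen on the path. The first layer is paired with X by Hoelder's inequality, so n_0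
    contributes no power of 4. *)
Lemma pathsum_bound Phi (p : R) (k : nat) (X : Op R (n 0)) (z : PIdx (n k.+1)) (c : R[i]) :
  1 <= p -> (forall i, (i < k.+1)%N -> linear_map (Phi i)) ->
  cabs (c * pcoef R (compose Phi k.+1 X) z) <=
  pathsum Phi p k.+1 z c `^ p^-1 *
  (\prod_(1 <= i < k.+1) 4 `^ ((n i)%:R * einv (hconj p)) *
   lpnorm (hconj p) (fun v : PIdx (n 0) => cabs (pcoef R X v))).
Proof.
move=> p1; have p0 : 0 < p by exact: lt_le_trans p1.
elim: k z c => [|k IH] z c lin.
  rewrite big_geq // mul1r [compose _ _ _]/= (pcoef_linear_map _ _ _ _ _ _ (lin 0%N _)) //.
  rewrite mulr_sumr; apply: le_trans (cabs_sum _ _ _) _.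
  have := hoelder_lpnorm R _ p (fun v => cabs (c * repmx (Phi 0%N) z v))
    (fun v => cabs (pcoef R X v)) p1.
  have -> : lpnorm p%:E (fun v => cabs (c * repmx (Phi 0%N) z v)) =
      pathsum Phi p 1 z c `^ p^-1.
    rewrite /lpnorm; congr (_ `^ _); apply: eq_bigr => v _.
    by rewrite (ger0_norm (cabs_ge0 _ _)).
  apply: le_trans; apply: ler_sum => v _.
  by rewrite mulrA cabsM ler_norm.
rewrite [compose _ _ _]/= (pcoef_linear_map _ _ _ _ _ _ (lin k.+1 _)) //.
rewrite mulr_sumr; apply: le_trans (cabs_sum _ _ _) _.
set B := \prod_(1 <= i < k.+2) _; set L := lpnorm (hconj p) _.
(* The new factor counts the Pauli indices on n_(k+1) qubits, to the power 1/p*, as [sum_le_lpnorm]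
   will produce it. *)
have BE : B = \prod_(1 <= i < k.+1) 4 `^ ((n i)%:R * einv (hconj p)) *
    #|PIdx (n k.+1)|%:R `^ einv (hconj p).
  by rewrite /B big_nat_recr //= powR_card_PIdx.
pose a v := pathsum Phi p k.+1 v (c * repmx (Phi k.+1) z v) `^ p^-1.
apply: (@le_trans _ _ (\sum_v a v *
   (\prod_(1 <= i < k.+1) 4 `^ ((n i)%:R * einv (hconj p)) * L))).
  apply: ler_sum => v _; rewrite mulrA; apply: IH => i ik.
  by apply: lin; exact: leqW.
have L0 : 0 <= L by exact: lpnorm_ge0.
have P0 : 0 <= \prod_(1 <= i < k.+1) 4 `^ ((n i)%:R * einv (hconj p)).
  by apply: prodr_ge0 => i _; exact: powR_ge0.
have h := sum_le_lpnorm R _ p a p1.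
have aE : \sum_v a v = \sum_v `|a v|.
  by apply: eq_bigr => v _; rewrite ger0_norm ?powR_ge0.
(* The p-th power of a_v is an inner path sum, so summing over v rebuilds the path sum of the deeper
   circuit. *)
have laE : lpnorm p%:E a = pathsum Phi p k.+2 z c `^ p^-1.
  rewrite /lpnorm; congr (_ `^ _); apply: eq_bigr => v _.
  rewrite (ger0_norm (powR_ge0 _ _)) /a -powRrM mulVf ?gt_eqF //.
  by rewrite powRr1 // pathsum_ge0.
rewrite laE -aE in h.
rewrite -mulr_suml BE.
apply: (le_trans (ler_wpM2r (mulr_ge0 P0 L0) h)).
by rewrite le_eqVlt; apply/orP; left; apply/eqP; ring.
Qed.

Lemma pcoef_compose_le Phi (p : R) (l : nat) (X : Op R (n 0)) (z : PIdx (n l)) :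
  (0 < l)%N -> 1 <= p -> (forall i, (i < l)%N -> linear_map (Phi i)) ->
  cabs (pcoef R (compose Phi l X) z) <=
  gamma_z Phi p l z *
  (\prod_(1 <= i < l) 4 `^ ((n i)%:R * einv (hconj p)) *
   lpnorm (hconj p) (fun v : PIdx (n 0) => cabs (pcoef R X v))).
Proof.
case: l z => // k z _ p1 lin.
by rewrite -[pcoef _ _ _]mul1r; exact: pathsum_bound.
Qed.

(** This treats finite and infinite q together: at q = +oo the normalizing power has exponent 0. *)
Lemma gamma_pq_lpnorm Phi (p : R) (q : \bar R) (l : nat) : (0 < q)%E ->
  gamma_pq Phi p q l =
  (#|PIdx (n l)|%:R `^ einv q)^-1 * lpnorm q (fun z => gamma_z Phi p l z).
Proof.
move=> q0; elim/ereal_gt0_ind: q / q0 => [r r0|] /=; last first.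
  rewrite powRr0 invr1 mul1r; apply: eq_bigr => z _.
  by rewrite ger0_norm ?powR_ge0.
have N0 : 0 <= 4 ^+ n l :> R by exact: exprn_ge0.
have S0 : 0 <= \sum_z gamma_z Phi p l z `^ r by apply: sumr_ge0 => z _; exact: powR_ge0.
have Ni : 0 <= (4 ^+ n l)^-1 :> R by rewrite invr_ge0.
rewrite (powRM _ Ni S0) (powRV _ _ _ N0) card_PIdx natrX.
congr (_ * _ `^ _).
by apply: eq_bigr => z _; rewrite ger0_norm ?powR_ge0.
Qed.

(** The trace pairs alpha with the Pauli coefficients of C(X). Hoelder's inequality takes alpha in
    p-norm and the path norms in p*-norm; the latter is then compared with the normalized q-norm
    [gamma_pq]. *)
Lemma circuit_bound Phi (p : R) (q : \bar R) (l : nat) (gam : R) (X : Op R (n 0))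
    (H : Op R (n l)) :
  (0 < l)%N -> 1 <= p -> (0 < q)%E ->
  (forall i, (i < l)%N -> linear_map (Phi i)) -> gamma_pq Phi p q l <= gam ->
  cabs (trace (mulop (compose Phi l X) H)) <=
  gam * 4 `^ ((n l)%:R * Num.max (einv (hconj p)) (einv q)) *
  (\prod_(1 <= i < l) 4 `^ ((n i)%:R * einv (hconj p))) *
  lpnorm p%:E (fun z : PIdx (n l) => cabs (trace (mulop (pauli z) H))) *
  lpnorm (hconj p) (fun v : PIdx (n 0) => cabs (pcoef R X v)).
Proof.
move=> l0 p1 q0 lin gle.
set L := lpnorm (hconj p) (fun v => cabs _).
set P := \prod_(_ <= _ < _) _.
pose al z := cabs (trace (mulop (pauli z) H)).
pose ga z := gamma_z Phi p l z.
rewrite -[lpnorm p%:E _]/(lpnorm p%:E al).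
have L0 : 0 <= L by exact: lpnorm_ge0.
have P0 : 0 <= P by apply: prodr_ge0 => i _; exact: powR_ge0.
have al0 : 0 <= lpnorm p%:E al by exact: lpnorm_ge0.
have bd z : cabs (pcoef R (compose Phi l X) z) <= ga z * (P * L).
  exact: pcoef_compose_le.
rewrite trace_mulop_pauli; apply: le_trans (cabs_sum _ _ _) _.
apply: (@le_trans _ _ ((\sum_z `|al z * ga z|) * (P * L))).
  rewrite mulr_suml; apply: ler_sum => z _.
  rewrite normrM (ger0_norm (cabs_ge0 _ _)) (ger0_norm (powR_ge0 _ _)).
  by rewrite cabsM mulrC -mulrA; apply: ler_wpM2l; [exact: cabs_ge0|exact: bd].
have PL0 : 0 <= P * L by exact: mulr_ge0.
apply: (le_trans (ler_wpM2r PL0 (hoelder_lpnorm _ _ p al ga p1))).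
have N0 : 0 < #|PIdx (n l)|%:R :> R by rewrite card_PIdx ltr0n expn_gt0.
have gaq : lpnorm (hconj p) ga <=
    4 `^ ((n l)%:R * Num.max (einv (hconj p)) (einv q)) * gam.
  have := lpnorm_compare _ _ _ _ ga (hconj_gt0 _ p p1) q0.
  move=> /le_trans; apply.
  (* The comparison has exponent max(1/p*, 1/q) - 1/q, and the subtracted 1/q is the normalization
     inside [gamma_pq]. *)
  rewrite powRB ?(gt_eqF N0) ?implybT // -mulrA -gamma_pq_lpnorm //.
  by rewrite powR_card_PIdx; apply: ler_wpM2l; [exact: powR_ge0|].
apply: (@le_trans _ _ (lpnorm p%:E al *
    (4 `^ ((n l)%:R * Num.max (einv (hconj p)) (einv q)) * gam) * (P * L))).
  by apply: ler_wpM2r => //; apply: ler_wpM2l.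
by rewrite le_eqVlt; apply/orP; left; apply/eqP; ring.
Qed.

End Circuits.

(** * Rademacher complexity *)

(** The number 4^(1/4) = (4^N)^(1/(4N)) is the price of lowering the exponent to 4N on 4^N
    coordinates. *)
Lemma powR4_quarter {R : realType} : 4 `^ (4^-1) = Num.sqrt 2 :> R.
Proof.
have {1}-> : 4 = 2 `^ 2%:R :> R by rewrite powR_mulrn // -natrX.
rewrite -powR12_sqrt //.
by rewrite -powRrM; congr (_ `^ _); field.
Qed.

(* When r > 8N the norms are compared with the exponent s = 4N, for which
   sqrt s * (4^N)^(1/s) = sqrt (8N). *)
Lemma average_lpnorm_min {R : realType} {m : nat} {T : finType} (f : 'I_m -> T -> R)
    (K : R) (N : nat) (r : \bar R) :
  (2%:E <= r)%E -> #|T| = (4 ^ N)%N -> (0 < N)%N -> (0 < m)%N ->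
  (forall i, lpnorm r (f i) <= K) ->
  average R m (fun eps => lpnorm r (fun z => rsum R m (f ^~ z) eps)) <=
  Num.sqrt (fine (Order.min r ((8 * N)%:R)%:E)) * Num.sqrt m%:R * K.
Proof.
move=> r2 cT N0 m0 fK; have [rN|Nr] := leP r ((8 * N)%:R)%:E.
  case: r r2 fK rN => [r| |] //= r2 fK _; first exact: average_lpnorm_ge2.
pose s : R := 4 * N%:R.
have N1 : 1 <= N%:R :> R by rewrite ler1n.
have s0 : 0 < s by rewrite /s; lra.
have r0 : (0 < r)%E by apply: lt_le_trans r2; rewrite lte_fin.
have sr : (s%:E <= r)%E.
  by apply: le_trans (ltW Nr); rewrite lee_fin natrM /s; lra.
have K0 : 0 <= K by exact: le_trans (lpnorm_ge0 _ _ _ _) (fK (Ordinal m0)).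
have er0 : 0 <= einv r.
  by elim/ereal_gt0_ind: r / r0 {r2 fK Nr sr} => [t t0|] //=; rewrite invr_ge0 ltW.
have fs i : lpnorm s%:E (f i) <= Num.sqrt 2 * K.
  have s0' : (0 < s%:E)%E by rewrite lte_fin.
  apply: (le_trans (lpnorm_le_mean _ _ _ _ (f i) s0' sr)).
  apply: ler_pM; [exact: powR_ge0|exact: lpnorm_ge0| |exact: fK].
  rewrite -powR4_quarter cT natrX -powR_mulrn // -powRrM.
  apply: ler_powR; first by rewrite ler1n.
  rewrite [einv s%:E]/= mulrBr (_ : N%:R * s^-1 = 4^-1).
    by rewrite lerBlDr lerDl mulr_ge0.
  by rewrite /s; field; rewrite gt_eqF // (lt_le_trans _ N1).
have s2 : 2 <= s by rewrite /s; lra.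
have := average_lpnorm_ge2 R m T f (Num.sqrt 2 * K) s s2 m0 fs.
have -> : Num.sqrt s * Num.sqrt m%:R * (Num.sqrt 2 * K) =
    Num.sqrt (fine ((8 * N)%:R)%:E) * Num.sqrt m%:R * K.
  rewrite (_ : fine _ = s * 2); last by rewrite /= natrM /s; ring.
  by rewrite (sqrtrM _ (ltW s0)); ring.
(* Back to exponent r: norms decrease in the exponent, and s <= r. *)
apply: le_trans; apply: ler_average => eps.
by apply: lpnorm_antitone => //; rewrite lte_fin.
Qed.

(** * From circuits to the average norm of a Rademacher sum *)

Section Reduction.
Variables (R : realType) (X : Type) (n : nat -> nat) (l m : nat).
Variables (gam p : R) (q : \bar R) (rho : X -> Op R (n 0)) (H : Op R (n l)).
Variable xs : 'I_m -> X.

(** For Hermitian states taking the real part loses nothing, and it gives the real vectors that the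
    sign averages require. *)
Definition input_coef (i : 'I_m) (v : PIdx (n 0)) : R :=
  complex.Re (pcoef R (rho (xs i)) v).

(** The circuit and the trace are linear, so the signs move inside and [circuit_bound] applies once,
    to the signed sum of the input states. *)
Lemma signed_sum_le (Phi : forall i : nat, Op R (n i) -> Op R (n i.+1))
    (eps : {ffun 'I_m -> bool}) :
  (0 < l)%N -> 1 <= p -> (0 < q)%E -> (forall x, herm_op (rho x)) ->
  (forall i, (i < l)%N -> linear_map (Phi i)) -> gamma_pq Phi p q l <= gam ->
  cabs (\sum_(i < m) (if eps i then 1 else -1) *
     trace (mulop (compose Phi l (rho (xs i))) H)) <=
  gam * 4 `^ ((n l)%:R * Num.max (einv (hconj p)) (einv q)) *
  (\prod_(1 <= i < l) 4 `^ ((n i)%:R * einv (hconj p))) *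
  lpnorm p%:E (fun z : PIdx (n l) => cabs (trace (mulop (pauli z) H))) *
  lpnorm (hconj p) (fun v => rsum R m (input_coef ^~ v) eps).
Proof.
move=> l0 p1 q0 hrho lin gle.
pose sg (i : 'I_m) : R[i] := if eps i then 1 else -1.
have := circuit_bound R n Phi p q l gam
  (fun s t => \sum_i sg i * rho (xs i) s t) H l0 p1 q0 lin gle.
rewrite (linear_map_sum _ _ _ _ _ _ _ (linear_map_compose _ _ _ _ lin)).
rewrite trace_mulop_suml => /le_trans; apply.
(* The path norm is nonnegative, hence so is its upper bound. *)
have G0 : 0 <= gam.
  apply: le_trans gle; rewrite gamma_pq_lpnorm //.
  by apply: mulr_ge0; [rewrite invr_ge0 powR_ge0|exact: lpnorm_ge0].
apply: ler_wpM2l.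
  apply: mulr_ge0; last exact: lpnorm_ge0.
  apply: mulr_ge0; first by apply: mulr_ge0 => //; exact: powR_ge0.
  by apply: prodr_ge0 => i _; exact: powR_ge0.
apply: le_lpnorm; first exact: hconj_gt0.
move=> v; rewrite pcoef_sum (ger0_norm (cabs_ge0 _ _)).
rewrite (_ : \sum_i _ = (rsum R m (input_coef ^~ v) eps)%:C%C) ?cabs_real //.
rewrite /rsum rmorph_sum; apply: eq_bigr => i _.
rewrite rmorphM /= (pcoef_herm_real _ _ _ _ (hrho _)) /sg /rsign.
by case: (eps i); rewrite ?rmorphN rmorph1.
Qed.

(** The bound of [signed_sum_le] does not depend on the circuit, so it bounds the supremum for each
    sign vector. *)
Lemma rademacher_le :
  (0 < l)%N -> 1 <= p -> (0 < q)%E -> (forall x, herm_op (rho x)) ->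
  (rademacher n rho H xs p q gam <=
   (gam * 4 `^ ((n l)%:R * Num.max (einv (hconj p)) (einv q)) *
    (\prod_(1 <= i < l) 4 `^ ((n i)%:R * einv (hconj p))) *
    lpnorm p%:E (fun z : PIdx (n l) => cabs (trace (mulop (pauli z) H))) *
    (m%:R^-1 * average R m (fun eps =>
       lpnorm (hconj p) (fun v => rsum R m (input_coef ^~ v) eps))))%:E)%E.
Proof.
move=> l0 p1 q0 hrho; rewrite /rademacher.
set G := gam * _ * _ * _.
rewrite (_ : G * _ = \sum_(eps : {ffun 'I_m -> bool}) ((2 ^+ m)^-1 * m%:R^-1) *
    (G * lpnorm (hconj p) (fun v => rsum R m (input_coef ^~ v) eps))); last first.
  by rewrite -!mulr_sumr /average; ring.
rewrite -sumEFin; apply: lee_sum => eps _; rewrite [X in (_ <= X)%E]EFinM.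
apply: lee_wpmul2l; first by rewrite lee_fin mulr_ge0 ?invr_ge0 ?exprn_ge0.
apply: ge_ereal_sup => _ [Phi [chan gle] <-]; rewrite lee_fin.
by apply: signed_sum_le => // i il; have [] := chan i il.
Qed.

Lemma lpnorm_input_coef_le (i : 'I_m) : 1 <= p -> (forall x, herm_op (rho x)) ->
  lpnorm (hconj p) (input_coef i) <=
  \big[Order.max/0]_(i < m)
     lpnorm (hconj p) (fun z : PIdx (n 0) =>
        cabs ((2 ^+ n 0)^-1 * trace (mulop (pauli z) (rho (xs i))))).
Proof.
move=> p1 hrho; apply: le_trans; last first.
  exact: (le_bigmax _ (fun i : 'I_m => lpnorm (hconj p) _) i).
apply: le_lpnorm; first exact: hconj_gt0.
move=> z; rewrite -/(pcoef R (rho (xs i)) z) (pcoef_herm_real _ _ _ _ (hrho _)).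
by rewrite cabs_real normr_id.
Qed.

End Reduction.

Theorem mainTheorem7 (R : realType) (X : Type) (n : nat -> nat) (l m : nat)
    (gam p : R) (q : \bar R) (rho : X -> Op R (n 0)) (H : Op R (n l))
    (xs : 'I_m -> X) :
  (1 <= l)%N -> (forall i, (i <= l)%N -> (1 <= n i)%N) ->
  0 < gam -> 1 <= p -> (0 < q)%E ->
  (forall x, pure_state (rho x)) -> herm_op H -> (0 < m)%N ->
  (p <= 2 ->
   (rademacher n rho H xs p q gam <=
    (gam * 4 `^ ((n l)%:R * Num.max (einv (hconj p)) (einv q))
     * (\prod_(1 <= i < l) 4 `^ ((n i)%:R * einv (hconj p)))
     * Num.sqrt (fine (Order.min (hconj p) ((8 * n 0)%:R)%:E)) / Num.sqrt m%:R
     * Kp rho H xs p)%:E)%E)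
  /\
  (2 < p ->
   (rademacher n rho H xs p q gam <=
    (gam * 4 `^ ((n l)%:R * Num.max (einv (hconj p)) (einv q))
     * (\prod_(1 <= i < l) 4 `^ ((n i)%:R * einv (hconj p)))
     * Num.sqrt (fine (hconj p)) / m%:R `^ p^-1
     * Kp rho H xs p)%:E)%E).
Proof.
move=> l1 n1 gam0 p1 q0 pure _ m0.
have hrho x : herm_op (rho x) by exact: pure_state_herm.
have mR : 0 < m%:R :> R by rewrite ltr0n.
have fK i := lpnorm_input_coef_le R X n m p rho xs i p1 hrho.
rewrite /Kp; move: fK; set K := \big[_/_]_i _ => fK.
have K0 : 0 <= K by exact: le_trans (lpnorm_ge0 _ _ _ _) (fK (Ordinal m0)).
have := rademacher_le R X n l m gam p q rho H xs l1 p1 q0 hrho.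
set al := lpnorm p%:E _; set Pi := \prod_(_ <= _ < _) _; set E4 := 4 `^ _.
have G0 : 0 <= gam * E4 * Pi * al.
  apply: mulr_ge0; last exact: lpnorm_ge0.
  apply: mulr_ge0; first by apply: mulr_ge0; [exact: ltW|exact: powR_ge0].
  by apply: prodr_ge0 => i _; exact: powR_ge0.
move=> radle; split=> hp; apply: (le_trans radle); rewrite lee_fin.
(* For p <= 2 the conjugate p* lies in [2, +oo], the range of [average_lpnorm_min]. *)
- have h2 : (2%:E <= hconj p)%E.
    rewrite /hconj; case: eqP => [_|/eqP pn1]; first exact: leey.
    have p1' : 0 < p - 1 by rewrite subr_gt0 lt_neqAle eq_sym pn1.
    by rewrite lee_fin ler_pdivlMr //; lra.
  have := average_lpnorm_min _ K (n 0%N) (hconj p) h2 (card_PIdx _) (n1 0%N isT) m0 fK.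
  move: (average _ _ _) => A.
  move: (Num.sqrt (fine _)) => S AS.
  have sm : m%:R^-1 * (S * Num.sqrt m%:R * K) = S / Num.sqrt m%:R * K.
    have sm0 : Num.sqrt m%:R != 0 :> R by rewrite gt_eqF // sqrtr_gt0.
    rewrite -{1}(sqr_sqrtr (ltW mR)).
    by field.
  rewrite (_ : _ * _ * _ * S / _ * _ = gam * E4 * Pi * al * (m%:R^-1 * (S * Num.sqrt m%:R * K))).
    by apply: ler_wpM2l => //; apply: ler_wpM2l; rewrite ?invr_ge0 ?(ltW mR).
  by rewrite sm; ring.
- have p10 : 0 < p - 1 by rewrite subr_gt0 (lt_trans _ hp) // ltr1n.
  have hE : hconj p = (p / (p - 1))%:E by rewrite /hconj gt_eqF // -subr_gt0.
  have r1 : 1 <= p / (p - 1) by rewrite ler_pdivlMr //; lra.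
  have r2 : p / (p - 1) <= 2 by rewrite ler_pdivrMr //; lra.
  move: fK; rewrite hE => fK.
  have := average_lpnorm_le2 R m _ (input_coef R X n m rho xs) K _ r1 r2 m0 fK.
  move: (average _ _ _) => A AK.
  have rE : (p / (p - 1))^-1 = 1 - p^-1.
    by have := einv_hconj R p p1; rewrite hE.
  (* Since 1/p* = 1 - 1/p, the powers of m combine to m^(-1/p). *)
  have mE : m%:R^-1 * (m%:R `^ (p / (p - 1))^-1 * K) = K / m%:R `^ p^-1.
    rewrite rE powRB ?(gt_eqF mR) ?implybT // (powRr1 (ltW mR)) mulrA.
    by rewrite mulKf ?gt_eqF // mulrC.
  have s1 : 1 <= Num.sqrt (fine (p / (p - 1))%:E).
    by rewrite -[leLHS]sqrtr1 ler_wsqrtr.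
  apply: (@le_trans _ _ (gam * E4 * Pi * al * (K / m%:R `^ p^-1))).
    by rewrite -mE; apply: ler_wpM2l => //; apply: ler_wpM2l; rewrite ?invr_ge0 ?(ltW mR).
  move: (Num.sqrt _) s1 => S S1.
  have Km : 0 <= K / m%:R `^ p^-1 by rewrite divr_ge0 ?powR_ge0.
  rewrite (_ : _ * S / _ * _ = S * (gam * E4 * Pi * al * (K / m%:R `^ p^-1))).
    by rewrite ler_peMl // mulr_ge0.
  ring.
Qed.
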